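(* Consider the network revenue management problem with Markovian-correlated customer arrivals described in the context, and let $L=\max_{j\in[n]}\sum_{i\in[m]}a_{i,j}$. Let $\mathsf{ALG}$ denote the expected total reward collected by the Bid Price Policy (Algorithm 1, described in the context) and let $\mathsf{OPT}$ denote the expected total reward collected by an optimal online policy. Then \[ \mathsf{ALG}\geq \frac{1}{1+L}\cdot \mathsf{OPT}. \]
   Context: There are $m$ resources; resource $i\in[m]$ has initial capacity $C_i>0$. There are $n$ customer types (products); type $j\in[n]$ has reward $r_j$ and size vector $\bm a_j=(a_{1,j},\dots,a_{m,j})\in\{0,1\}^m$. Let $\mathcal A_j=\{i\in[m]:a_{i,j}=1\}$ and $\mathcal B_i=\{j\in[n]:a_{i,j}=1\}$. There is a finite state space $\mathcal S$ and a map $s\mapsto j(s)\in[n]$. Over periods $t=1,\dots,T$ the states $s_1,\dots,s_T$ form a time-inhomogeneous Markov chain: $P(s_1=s)=p_1(s)$ and $P(s_{t+1}=s'\mid s_t=s)=p_t(s,s')$. At period $t$ the state $s_t$ is revealed and customer $t$, of type $j(s_t)$, arrives; the decision maker must immediately and irrevocably decide whether to serve it, using only the instance (the probabilities) and $s_1,\dots,s_t$. Serving is allowed only if the current remaining capacity vector $\bm c_t$ satisfies $\bm c_t\ge \bm a_{j(s_t)}$ componentwise; serving consumes $\bm a_{j(s_t)}$ and earns $r_{j(s_t)}$. An optimal online policy maximizes the expected total reward among all such (possibly randomized) feasible online policies. Bid prices: set $\nu^{T+1}_j(s)=0$ for all $j,s$, and for $t=T,T-1,\dots,1$, all $j\in[n]$,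 $s\in\mathcal S$, \[ \nu^t_j(s)=\sum_{s'\in\mathcal S}p_t(s,s')\nu^{t+1}_j(s')+\mathbb 1_{\{j=j(s)\}}\Big[r_j-\sum_{s'\in\mathcal S}p_t(s,s')\sum_{i\in\mathcal A_j}\frac{1}{C_i}\sum_{j'\in\mathcal B_i}\nu^{t+1}_{j'}(s')\Big]^+ . \] Algorithm 1 (Bid Price Policy): at each period $t$, observe $s_t$ and $\bm c_t$; if $c_{t,i}<a_{i,j(s_t)}$ for some $i$, reject customer $t$; otherwise serve customer $t$ if and only if \[ r_{j(s_t)}\ge \sum_{s'\in\mathcal S}p_t(s_t,s')\sum_{i\in\mathcal A_{j(s_t)}}\frac{1}{C_i}\sum_{j'\in\mathcal B_i}\nu^{t+1}_{j'}(s'). \]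
   Formalization: The initial capacities C_i are taken to be positive integers, whereas the context only says C_i>0; for fractional capacities (e.g. C_1=1.99 with C_2 a large integer and L=2) the claimed bound fails. *)

(* Defs.v *)
From mathcomp Require Import all_boot all_order all_algebra.
From mathcomp Require Import classical_sets reals.

Set Implicit Arguments.
Unset Strict Implicit.
Unset Printing Implicit Defensive.

Import Order.TTheory GRing.Theory Num.Theory.
Local Open Scope ring_scope.

(* Resources, products and periods are numbered from 1 in the mathematics;
   here resources and products are ordinals, whereas the time argument [t] of
   [trans] and of everything below is the 1-based period t = 1, ..., T.
   Capacities are whole numbers of units: a request takes 0 or 1 unit, and with
   fractional capacities the 1/(1+L) guarantee fails. *)
Record nrm (R : realType) (m n T : nat) (S : finType) := NRM {
  capacity : 'I_m -> nat;
  reward : 'I_n -> R;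
  uses : 'I_m -> 'I_n -> bool;
  type_of : S -> 'I_n;
  init : S -> R;
  trans : nat -> S -> S -> R
}.

Definition is_distr (R : realType) (S : finType) (f : S -> R) : Prop :=
  (forall s, 0 <= f s) /\ \sum_s f s = 1.

Section Model.
Variables (R : realType) (m n T : nat) (S : finType) (I : nrm R m n T S).

(* No condition on [trans I T]: it only ever multiplies nu^{T+1} = 0. *)
Definition markovian : Prop :=
  is_distr (init I) /\
  forall t, (1 <= t < T)%N -> forall s, is_distr (trans I t s).

Definition max_size : nat := (\max_(j < n) \sum_(i < m) uses I i j)%N.

Fixpoint trans_prob (t : nat) (s : S) (w : seq S) : R :=
  if w is s' :: w' then trans I t s s' * trans_prob t.+1 s' w' else 1.

Definition path_prob (w : seq S) : R :=
  if w is s :: w' then init I s * trans_prob 1 s w' else 1.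

(* A history lists, for the past periods in order, the state and whether the
   customer was served; the period that follows h is (size h).+1. *)
Definition history := seq (S * bool).

Definition remaining (h : history) (i : 'I_m) : nat :=
  (capacity I i - \sum_(z <- h | z.2) uses I i (type_of I z.1))%N.

Definition can_serve (h : history) (s : S) : bool :=
  [forall i, (uses I i (type_of I s) <= remaining h i)%N].

(* pi h s is the probability of serving a customer in state s after h.
   Keeping the past decisions in h makes this cover every policy that draws
   on a random seed independent of the states: pi h s is then the conditional
   probability of serving given the observed states and past decisions. *)
Definition policy := history -> S -> R.

Definition feasible (pi : policy) : Prop :=
  forall h s, 0 <= pi h s <= 1 /\ (~~ can_serve h s -> pi h s = 0).

Definition decision_prob (pi : policy) (w : T.-tuple (S * bool)) : R :=
  \prod_(k < T)
    let q := pi (take k w) (tnth w k).1 in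
    if (tnth w k).2 then q else 1 - q.

Definition total_reward (w : history) : R :=
  \sum_(z <- w | z.2) reward I (type_of I z.1).

Definition expected_reward (pi : policy) : R :=
  \sum_(w : T.-tuple (S * bool))
    path_prob [seq z.1 | z <- w] * decision_prob pi w * total_reward w.

Definition bid (v : 'I_n -> S -> R) (t : nat) (j : 'I_n) (s : S) : R :=
  \sum_s' trans I t s s' *
    \sum_(i < m | uses I i j)
      ((capacity I i)%:R)^-1 * \sum_(j' < n | uses I i j') v j' s'.

(* nu_to_go k is nu^{T+1-k}; see nu_last and nu_rec for the usual form. *)
Fixpoint nu_to_go (k : nat) : 'I_n -> S -> R :=
  if k is k'.+1 then fun j s =>
    let t := (T - k')%N in
    \sum_s' trans I t s s' * nu_to_go k' j s' +
    (if j == type_of I s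
     then Num.max 0 (reward I j - bid (nu_to_go k') t j s) else 0)
  else fun _ _ => 0.

Definition nu (t : nat) : 'I_n -> S -> R := nu_to_go (T.+1 - t).

Lemma nu_last j s : nu T.+1 j s = 0.
Proof. by rewrite /nu subnn. Qed.

Lemma nu_rec t j s : (1 <= t <= T)%N ->
  nu t j s = \sum_s' trans I t s s' * nu t.+1 j s' +
    (if j == type_of I s
     then Num.max 0 (reward I j - bid (nu t.+1) t j s) else 0).
Proof. by case/andP=> _ tT; rewrite /nu subSn //= subKn. Qed.

Definition bid_price_policy : policy := fun h s =>
  let t := (size h).+1 in
  if can_serve h s && (bid (nu t.+1) t (type_of I s) s <= reward I (type_of I s))
  then 1 else 0.

Definition ALG : R := expected_reward bid_price_policy.

(* The set is nonempty and bounded above, and the supremum is attained: it is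
   the value of an optimal policy. *)
Definition OPT : R :=
  sup [set v | exists2 pi, feasible pi & v = expected_reward pi]%classic.

End Model.

(* Main.v *)
Require Import Defs.
From mathcomp Require Import all_boot all_order all_algebra.
From mathcomp Require Import classical_sets reals.
From mathcomp Require Import ring lra.
Import Order.TTheory GRing.Theory Num.Theory.
Local Open Scope ring_scope.

(* With [c] the remaining capacities, consider the potentials
   [Phi^t(s, x) = sum_j nu^t_j(s) (1 + sum_(i in A_j) x_i)] for
   [x_i = c_i / C_i] and for [x_i = c_i / C_i - 1].  Serving type [j] lowers
   both by exactly the bid price of [j] in expectation, so by backward induction
   the first one dominates the reward-to-go of every feasible policy, while the
   second one is dominated by that of the bid price policy.  At full capacity the
   first is at most [(1 + L) sum_j nu^1_j] and the second equals
   [sum_j nu^1_j]. *)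

(** * Sums over tuples, one entry at a time *)

Lemma big_tuple_nil {R : nmodType} {A : finType} (F : seq A -> R) :
  \sum_(w : 0.-tuple A) F w = F [::].
Proof. by rewrite (big_pred1 [tuple]) // => w; apply/esym/eqP/tuple0. Qed.

Lemma big_tuple_cons {R : nmodType} {A : finType} {k} (F : seq A -> R) :
  \sum_(w : k.+1.-tuple A) F w = \sum_a \sum_(w : k.-tuple A) F (a :: w).
Proof.
rewrite pair_big /=.
rewrite (reindex (fun p : A * k.-tuple A => [tuple of p.1 :: p.2])) //=.
exists (fun w : k.+1.-tuple A => (thead w, [tuple of behead w])) => [[a w] _|w _].
  by congr pair; apply: val_inj.
by rewrite /= -tuple_eta.
Qed.

(** * Expected reward as a recursion over periods *)

Section RewardToGo.
Set Implicit Arguments.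
Unset Strict Implicit.
Variables (R : realType) (m n T : nat) (S : finType) (I : nrm R m n T S).
Implicit Types (pi : policy R S) (h : history S) (s : S) (k : nat).

Definition choice_prob (pi : policy R S) (h : history S) (z : S * bool) : R :=
  if z.2 then pi h z.1 else 1 - pi h z.1.

(** The product in [decision_prob] as a recursion with the past [h] as accumulator, so that an
    induction can peel off the first remaining period. *)
Fixpoint choices_prob (pi : policy R S) (h w : history S) : R :=
  if w is z :: w' then choice_prob pi h z * choices_prob pi (rcons h z) w'
  else 1.

Lemma choices_probE pi k h (w : k.-tuple (S * bool)) :
  \prod_(i < k) choice_prob pi (h ++ take i w) (tnth w i) = choices_prob pi h w.
Proof.
elim: k h w => [|k IH] h w; first by rewrite big_ord0 tuple0.
case/tupleP: w => z w; rewrite big_ord_recl /= cats0 tnth0 -IH.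
by congr (_ * _); apply: eq_bigr => i _; rewrite tnthS -cats1 -catA.
Qed.

Lemma sum_choice_prob pi h s :
  choice_prob pi h (s, true) + choice_prob pi h (s, false) = 1.
Proof. by rewrite /choice_prob /= addrC subrK. Qed.

(** The law [f] of the first state is a parameter: [init I] gives the probability of a whole path, a
    row of [trans I] that of a continuation. *)
Definition path_weight (f : S -> R) (t : nat) (w : history S) : R :=
  if w is z :: w' then f z.1 * trans_prob I t z.1 [seq y.1 | y <- w'] else 1.

Lemma trans_prob_weight t s (w : history S) :
  trans_prob I t s [seq z.1 | z <- w] = path_weight (trans I t s) t.+1 w.
Proof. by case: w. Qed.

Lemma sum_state_choice (F : S * bool -> R) :
  \sum_z F z = \sum_s (F (s, true) + F (s, false)).
Proof.
rewrite [RHS](eq_bigr (fun s => \sum_b F (s, b))) => [|s _]; last first.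
  by rewrite big_bool.
by rewrite pair_big; apply: eq_bigr => -[].
Qed.

(** Dynamic programming for a fixed policy: [s] is the observed state of period [(size h).+1], and
    [k] periods remain, this one included. *)
Fixpoint to_go (pi : policy R S) (k : nat) (h : history S) (s : S) : R :=
  if k is k'.+1 then
    let next b :=
      \sum_s' trans I (size h).+1 s s' * to_go pi k' (rcons h (s, b)) s' in
    pi h s * (reward I (type_of I s) + next true) + (1 - pi h s) * next false
  else 0.

Hypothesis markovian_I : markovian I.

Lemma trans_distr t s : (0 < t < T)%N -> is_distr (trans I t s).
Proof. by case: markovian_I => _ H tT; apply: H. Qed.

Lemma trans_distr_history k h s :
  (size h + k.+2)%N = T -> is_distr (trans I (size h).+1 s).
Proof.
by move=> hk; apply: trans_distr; rewrite -hk !addnS !ltnS leq_addr.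
Qed.

(** Given the first state and decision, the continuations have total weight 1 by induction; the two
    decisions add up to 1, and so does [f]. *)
Lemma sum_weight pi k h (f : S -> R) :
  (size h + k)%N = T -> (0 < k)%N -> \sum_s f s = 1 ->
  \sum_(w : k.-tuple (S * bool))
     path_weight f (size h).+1 w * choices_prob pi h w = 1.
Proof.
elim: k h f => // k IH h f hk _ f1.
rewrite (big_tuple_cons (fun w => path_weight f _ w * choices_prob pi h w)).
rewrite sum_state_choice -[RHS]f1; apply: eq_bigr => s _.
have E b : \sum_(w : k.-tuple (S * bool))
   path_weight f (size h).+1 ((s, b) :: w) * choices_prob pi h ((s, b) :: w)
   = f s * choice_prob pi h (s, b).
  (* With no period left, the empty continuation has weight 1; otherwise the current period precedes
     [T] and its transition row is a distribution. *)
  rewrite -[RHS]mulr1; case: k IH hk => [|k] IH hk.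
    rewrite (big_tuple_nil (fun w => path_weight f _ ((s, b) :: w)
      * choices_prob pi h ((s, b) :: w))) /=.
    by rewrite !mulr1.
  rewrite -[in RHS](IH (rcons h (s, b)) (trans I (size h).+1 s)) //; last 2 first.
  - by rewrite size_rcons -hk addSnnS.
  - by case: (trans_distr_history s hk).
  rewrite mulr_sumr; apply: eq_bigr => w _.
  by rewrite [path_weight _ _ (_ :: _)]/= trans_prob_weight size_rcons /=; ring.
by rewrite !E -mulrDr sum_choice_prob mulr1.
Qed.

(** The reward of the first period is constant over continuations, whose weights [P] add up to 1;
    the later rewards are the induction hypothesis with the transition row as [f]. *)
Lemma sum_weight_reward pi k h (f : S -> R) :
  (size h + k)%N = T ->
  \sum_(w : k.-tuple (S * bool))
     path_weight f (size h).+1 w * choices_prob pi h w * total_reward I w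
  = \sum_s f s * to_go pi k h s.
Proof.
elim: k h f => [|k IH] h f hk.
  rewrite [RHS]big1 => [|s _]; last by rewrite mulr0.
  by rewrite big1 // => w _; rewrite tuple0 /total_reward big_nil mulr0.
rewrite (big_tuple_cons
  (fun w => path_weight f _ w * choices_prob pi h w * total_reward I w)).
rewrite sum_state_choice; apply: eq_bigr => s _.
have hk' b : (size (rcons h (s, b)) + k)%N = T by rewrite size_rcons -hk addSnnS.
have E b : \sum_(w : k.-tuple (S * bool))
   path_weight f (size h).+1 ((s, b) :: w) * choices_prob pi h ((s, b) :: w)
     * total_reward I ((s, b) :: w)
   = f s * choice_prob pi h (s, b) * ((if b then reward I (type_of I s) else 0) +
     \sum_s' trans I (size h).+1 s s' * to_go pi k (rcons h (s, b)) s').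
  rewrite -IH //.
  set P := fun w : history S => path_weight (trans I (size h).+1 s) (size h).+2 w
    * choices_prob pi (rcons h (s, b)) w.
  have P1 : \sum_(w : k.-tuple (S * bool)) P w = 1.
    case: k {IH} hk hk' => [|k] hk hk'.
      by rewrite (big_tuple_nil P) /P /= mulr1.
    have [_ f1] := trans_distr_history s hk.
    by have := sum_weight pi (hk' b) isT f1; rewrite size_rcons.
  rewrite -[X in _ * (X + _)]mulr1 -{1}P1 mulr_sumr -big_split mulr_sumr /=.
  apply: eq_bigr => w _.
  rewrite trans_prob_weight size_rcons /total_reward big_cons /= /P.
  by case: b {P P1} => /=; ring.
by rewrite !E /choice_prob /=; ring.
Qed.

Lemma expected_rewardE pi :
  expected_reward I pi = \sum_s init I s * to_go pi T [::] s.
Proof.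
rewrite -(@sum_weight_reward pi T [::]) //; apply: eq_bigr => w _.
congr (_ * _ * _); first by case: (tval w).
by rewrite -choices_probE.
Qed.

End RewardToGo.

(** * The two potentials and their drift *)

Section Potential.
Set Implicit Arguments.
Unset Strict Implicit.
Variables (R : realType) (m n T : nat) (S : finType) (I : nrm R m n T S).
Implicit Types (v : 'I_n -> S -> R) (x : 'I_m -> R) (h : history S) (s : S).
Hypothesis markovian_I : markovian I.

Definition load x (j : 'I_n) : R := 1 + \sum_(i < m | uses I i j) x i.

Definition potential v x s : R := \sum_j v j s * load x j.

(** The recursion for the bid prices is linear except for the positive part, which occurs only at
    the type of the current state and so is multiplied by the load of that type. *)
Lemma potential_step k x s :
  potential (nu_to_go I k.+1) x s =
  \sum_s' trans I (T - k) s s' * potential (nu_to_go I k) x s' +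
  Num.max 0 (reward I (type_of I s) - bid I (nu_to_go I k) (T - k) (type_of I s) s)
    * load x (type_of I s).
Proof.
rewrite /potential /=; under eq_bigr do rewrite mulrDl.
rewrite big_split /=; congr (_ + _).
  under [RHS]eq_bigr do rewrite mulr_sumr.
  rewrite exchange_big; apply: eq_bigr => j _.
  by rewrite mulr_suml; apply: eq_bigr => s' _; rewrite mulrA.
rewrite (bigD1 (type_of I s)) //= eqxx [X in _ + X]big1 ?addr0 // => j /negbTE ->.
by rewrite mul0r.
Qed.

(** The load of [j'] falls by [1 / C_i] for each resource [i] used by both [j] and [j']; exchanging
    the sums over [i] and [j'] turns the loss into the bid price. *)
Lemma potential_serve v x t j s :
  \sum_s' trans I t s s' *
     potential v (fun i => x i - (uses I i j)%:R / (capacity I i)%:R) s' =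
  \sum_s' trans I t s s' * potential v x s' - bid I v t j s.
Proof.
rewrite /bid -sumrB; apply: eq_bigr => s' _; rewrite -mulrBr; congr (_ * _).
under [X in _ - X]eq_bigr do rewrite mulr_sumr.
rewrite (exchange_big_dep xpredT) //= -sumrB; apply: eq_bigr => j' _.
rewrite /load sumrB addrA mulrBr; congr (_ - _).
rewrite mulr_sumr big_mkcond [RHS]big_mkcond; apply: eq_bigr => i _.
by case: (uses I i j); case: (uses I i j'); rewrite /= ?mul1r ?mul0r ?mulr0 // mulrC.
Qed.

Lemma trans_ge0 t s s' : (0 < t < T)%N -> 0 <= trans I t s s'.
Proof. by move=> tT; case: (trans_distr markovian_I s tT). Qed.

Lemma nu_to_go_ge0 k j s : (k <= T)%N -> 0 <= nu_to_go I k j s.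
Proof.
elim: k j s => // k IH j s kT /=; apply: addr_ge0.
  apply: sumr_ge0 => s' _; case: k IH kT => [|k] IH kT; first by rewrite mulr0.
  apply: mulr_ge0; last exact: IH (ltnW kT).
  by apply: trans_ge0; rewrite subn_gt0 kT /= ltn_subrL /= (leq_trans _ kT).
by case: ifP => // _; rewrite le_max lexx.
Qed.

(** The shift [d] covers both potentials: [d = 0] for the upper bound on all feasible policies,
    [d = 1] for the lower bound on the bid price policy. *)
Definition fill (d : R) h (i : 'I_m) : R :=
  (remaining I h i)%:R / (capacity I i)%:R - d.

Lemma remaining_rcons h s b i :
  remaining I (rcons h (s, b)) i =
  (remaining I h i - (b * uses I i (type_of I s)))%N.
Proof.
by rewrite /remaining -cats1 big_cat big_cons big_nil subnDA /=; case: b; rewrite ?mul1n ?addn0.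
Qed.

Lemma potential_reject v d h s s' :
  potential v (fill d (rcons h (s, false))) s' = potential v (fill d h) s'.
Proof.
apply: eq_bigr => j _; congr (_ * (_ + _)); apply: eq_bigr => i _.
by rewrite /fill remaining_rcons subn0.
Qed.

(** [can_serve] makes the truncated subtraction in [remaining] exact, so serving lowers [fill] as in
    [potential_serve]. *)
Lemma potential_accept v d h t s : can_serve I h s ->
  \sum_s' trans I t s s' * potential v (fill d (rcons h (s, true))) s' =
  \sum_s' trans I t s s' * potential v (fill d h) s'
    - bid I v t (type_of I s) s.
Proof.
move=> /forallP cs; rewrite -potential_serve; apply: eq_bigr => s' _; congr (_ * _).
apply: eq_bigr => j _; congr (_ * (_ + _)); apply: eq_bigr => i _.
by rewrite /fill remaining_rcons mul1n natrB ?cs // mulrBl addrAC.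
Qed.

(** Monotonicity of the expectation over the next state. For [k = 0] the row is that of period [T],
    whose signs [markovian] leaves free, so equality is asked there. *)
Lemma ler_trans_sum k h s (F G : S -> R) : (size h + k.+1)%N = T ->
  (k = 0%N -> forall s', F s' = G s') -> (forall s', F s' <= G s') ->
  \sum_s' trans I (size h).+1 s s' * F s' <= \sum_s' trans I (size h).+1 s s' * G s'.
Proof.
move=> hk F0 FG; apply: ler_sum => s' _; case: k F0 hk => [|k] F0 hk.
  by rewrite F0.
by apply: ler_wpM2l (FG s'); case: (trans_distr_history markovian_I s hk).
Qed.

Lemma potential0 x s : potential (nu_to_go I 0) x s = 0.
Proof. by rewrite /potential big1 // => j _; rewrite mul0r. Qed.

(** With [d = 0] every load is at least 1, so both serving, worth at most [r + P - b], and
    rejecting, worth at most [P], stay below [P + Num.max 0 (r - b) * l]; a randomized decision is a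
    convex combination of the two. *)
Lemma to_go_le pi k h s : feasible I pi -> (size h + k)%N = T ->
  to_go I pi k h s <= potential (nu_to_go I k) (fill 0 h) s.
Proof.
move=> fpi; elim: k h s => [|k IH] h s hk; first by rewrite potential0.
have hk' b : (size (rcons h (s, b)) + k)%N = T by rewrite size_rcons -hk addSnnS.
have tE : (T - k)%N = (size h).+1 by rewrite -hk addnS -addSn addnK.
rewrite potential_step tE /=.
set v := nu_to_go I k; set t := (size h).+1.
have step b : \sum_s' trans I t s s' * to_go I pi k (rcons h (s, b)) s'
   <= \sum_s' trans I t s s' * potential v (fill 0 (rcons h (s, b))) s'.
  apply: (@ler_trans_sum k) => // [k0 s'|s']; last exact: IH.
  by rewrite /v k0 potential0.
have := step false; have := step true.
under [X in _ -> _ <= X -> _]eq_bigr do rewrite potential_reject.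
set G1 := \sum_s' _; set P1 := \sum_s' _; set G0 := \sum_s' _; set P := \sum_s' _.
move=> GP1 GP0.
set r := reward _ _; set b := bid _ _ _ _ _; set l := load _ _.
have l1 : 1 <= l.
  rewrite /l /load lerDl; apply: sumr_ge0 => i _.
  by rewrite /fill subr0 divr_ge0.
have M0 : 0 <= Num.max 0 (r - b) by rewrite le_max lexx.
have Mr : r - b <= Num.max 0 (r - b) by rewrite le_max lexx orbT.
have Ml : Num.max 0 (r - b) <= Num.max 0 (r - b) * l by rewrite ler_peMr.
have [/andP[q0 q1] qn] := fpi h s.
case: (boolP (can_serve I h s)) => cs; last first.
  by rewrite (qn cs) mul0r add0r subr0 mul1r; lra.
have P1E : P1 = P - b by rewrite /P1 potential_accept.
have H1 : r + G1 <= P + Num.max 0 (r - b) * l by lra.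
have H0 : G0 <= P + Num.max 0 (r - b) * l by lra.
have := ler_wpM2l q0 H1; have := ler_wpM2l (_ : 0 <= 1 - pi h s) H0.
by rewrite subr_ge0 => /(_ q1); lra.
Qed.

(** With [d = 1] every load is at most 1, so the potential credits a period with at most
    [Num.max 0 (r - b)], and with at most 0 when a needed resource is exhausted. *)
Lemma to_go_ge k h s : (size h + k)%N = T ->
  potential (nu_to_go I k) (fill 1 h) s
  <= to_go I (bid_price_policy I) k h s.
Proof.
elim: k h s => [|k IH] h s hk; first by rewrite potential0.
have hk' b : (size (rcons h (s, b)) + k)%N = T by rewrite size_rcons -hk addSnnS.
have tE : (T - k)%N = (size h).+1 by rewrite -hk addnS -addSn addnK.
rewrite potential_step tE /=.
(* At period [(size h).+1] the policy reads the prices of the next period, from which [k] periods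
   remain. *)
have nuE : nu I (size h).+2 = nu_to_go I k.
  by rewrite /nu (_ : T.+1 - (size h).+2 = k)%N // -hk addnS !subSS addKn.
rewrite {1 3}/bid_price_policy nuE.
set v := nu_to_go I k; set t := (size h).+1; set pi := bid_price_policy I.
have step b : \sum_s' trans I t s s' * potential v (fill 1 (rcons h (s, b))) s'
   <= \sum_s' trans I t s s' * to_go I pi k (rcons h (s, b)) s'.
  apply: (@ler_trans_sum k) => // [k0 s'|s']; last exact: IH.
  by rewrite /v k0 potential0.
have := step false; have := step true.
under [X in _ -> X <= _ -> _]eq_bigr do rewrite potential_reject.
set P1 := \sum_s' _; set G1 := \sum_s' _; set P := \sum_s' _; set G0 := \sum_s' _.
move=> GP1 GP0.
set r := reward _ _; set b := bid _ _ _ _ _; set l := load _ _.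
have x_le0 i : fill 1 h i <= 0.
  (* For a zero capacity the quotient is 0, since the inverse of 0 is 0. *)
  rewrite /fill subr_le0; have [->|C0] := posnP (capacity I i).
    by rewrite invr0 mulr0.
  by rewrite ler_pdivrMr ?ltr0n // mul1r ler_nat leq_subr.
have l1 : l <= 1 by rewrite /l /load gerDl; apply: sumr_le0.
have M0 : 0 <= Num.max 0 (r - b) by rewrite le_max lexx.
have Ml : Num.max 0 (r - b) * l <= Num.max 0 (r - b) by rewrite ler_piMr.
case: (boolP (can_serve I h s)) => cs /=; last first.
  (* An exhausted resource has [fill] equal to -1, which cancels the constant 1 of the load; the
     other terms are nonpositive. *)
  have l0 : l <= 0.
    move: cs; rewrite negb_forall => /existsP[i].
    rewrite -ltnNge; case ui: (uses I i (type_of I s)) => //.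
    rewrite ltnS leqn0 => /eqP ci.
    rewrite /l /load (bigD1 i) //= {1}/fill ci mul0r sub0r addrA subrr add0r.
    exact: sumr_le0.
  by have := mulr_ge0_le0 M0 l0; lra.
have P1E : P1 = P - b by rewrite /P1 potential_accept.
(* Serving is chosen exactly when [r - b] is nonnegative, so either decision is worth at least
   [P + Num.max 0 (r - b)]. *)
case: (lerP b r) => br.
  have : Num.max 0 (r - b) = r - b by apply/max_idPr; rewrite subr_ge0.
  by lra.
have : Num.max 0 (r - b) = 0 by apply/max_idPl; rewrite subr_le0 ltW.
by move=> M; rewrite M in Ml *; lra.
Qed.

Lemma bid_price_policy_feasible : feasible I (bid_price_policy I).
Proof.
move=> h s; rewrite /bid_price_policy; case: (can_serve I h s) => /=.
  by split=> //; case: ifP; rewrite ?ler01 ?lexx.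
by rewrite lexx ler01.
Qed.

(** * Evaluation at full capacity *)

Hypothesis capacity_gt0 : forall i, (0 < capacity I i)%N.

Lemma fill_nil d i : fill d [::] i = 1 - d.
Proof.
by rewrite /fill /remaining big_nil subn0 divff // pnatr_eq0 -lt0n.
Qed.

Lemma init_ge0 s : 0 <= init I s.
Proof. by case: markovian_I => -[]. Qed.

Lemma ALG_ge : \sum_s init I s * \sum_j nu I 1 j s <= ALG I.
Proof.
rewrite /ALG expected_rewardE //; apply: ler_sum => s _.
apply: (ler_wpM2l (init_ge0 s)); apply: le_trans (@to_go_ge T [::] s _) => //.
rewrite /nu subn1 /=; apply: ler_sum => j _.
rewrite /load big1 ?addr0 ?mulr1 // => i _.
by rewrite fill_nil subrr.
Qed.

(** The bound holds for each feasible policy, hence for the supremum, the bid price policy showing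
    that the set is nonempty. At full capacity the load of a product is 1 plus its size. *)
Lemma OPT_le :
  OPT I <= (1 + (max_size I)%:R) * \sum_s init I s * \sum_j nu I 1 j s.
Proof.
apply: ge_sup.
  by exists (expected_reward I (bid_price_policy I)), (bid_price_policy I) => //;
    exact: bid_price_policy_feasible.
move=> _ [pi fpi ->]; rewrite expected_rewardE // mulr_sumr.
apply: ler_sum => s _; rewrite mulrCA; apply: (ler_wpM2l (init_ge0 s)).
apply: le_trans (@to_go_le pi T [::] s fpi _) _ => //.
rewrite mulr_sumr /nu subn1 /=; apply: ler_sum => j _.
rewrite mulrC; apply: ler_wpM2r; first exact: nu_to_go_ge0.
rewrite /load lerD2l; under eq_bigr do rewrite fill_nil subr0.
rewrite big_mkcond /= (eq_bigr (fun i => (uses I i j : nat)%:R)) => [|i _]; last first.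
  by case: (uses I i j).
by rewrite -natr_sum ler_nat /max_size (leq_bigmax_cond j).
Qed.

End Potential.

Theorem theorem1 (R : realType) (m n T : nat) (S : finType)
    (I : nrm R m n T S)
    (capacity_gt0 : forall i, (0 < capacity I i)%N)
    (markovian_I : markovian I) :
  ALG I >= 1 / (1 + (max_size I)%:R) * OPT I.
Proof.
have L0 : 0 < 1 + (max_size I)%:R :> R by rewrite ltr_pwDl.
rewrite mul1r ler_pdivrMl //.
apply: le_trans (OPT_le markovian_I capacity_gt0) _.
by rewrite ler_pM2l //; exact: ALG_ge.
Qed.
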